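(* For $n\ge1$, we have (a) $\displaystyle \widetilde C_n(t)=\frac12\sum_{u\in S_n}(4t)^{\mathrm{epk}(u)}(1+t)^{n+1-2\,\mathrm{epk}(u)}$, (b) $\displaystyle C_n(t)=\sum_{u\in S_n}(4t)^{\mathrm{lpk}(u)}(1+t)^{n-2\,\mathrm{lpk}(u)}$, (c) $\displaystyle A_{n-1}(t)=2^{-(n-1)}\sum_{u\in S_n}(4t)^{\mathrm{pk}(u)}(1+t)^{n-1-2\,\mathrm{pk}(u)}$.
   Context: $S_n$ is the symmetric group on $\{1,\dots,n\}$, with permutations written $u=u_1\cdots u_n$ and the convention $u_0=u_{n+1}=0$. The numbers of ordinary, left, and extended peaks of $u\in S_n$ are, respectively, $\mathrm{pk}(u):=|\{i: 2\le i\le n-1,\ u_{i-1}<u_i>u_{i+1}\}|$, $\mathrm{lpk}(u):=|\{i: 1\le i\le n-1,\ u_{i-1}<u_i>u_{i+1}\}|$, and $\mathrm{epk}(u):=|\{i: 1\le i\le n,\ u_{i-1}<u_i>u_{i+1}\}|$. The Weyl group $C_n$ is the group of signed permutations: permutations $w$ of $\{\pm1,\dots,\pm n\}$ with $w(-i)=-w(i)$, written $w=w_1\cdots w_n$ with $w_i=w(i)$. The descent set $\mathrm{Des}(w)$ of $w\in C_n$ consists of all $i\in\{1,\dots,n\}$ with $w_{i-1}>w_i$ (convention $w_0=0$). The affine descent set $\widetilde{\mathrm{Des}}(w)\subseteq\{0,1,\dots,n\}$ is $\mathrm{Des}(w)$ together with $0$ if $w_n>0$. The Eulerian and affine Eulerian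 polynomials of type $C$ are $C_n(t)=\sum_{w\in C_n}t^{|\mathrm{Des}(w)|}$ and $\widetilde C_n(t)=\sum_{w\in C_n}t^{|\widetilde{\mathrm{Des}}(w)|}$. The classical Eulerian polynomial is $A_{n-1}(t)=\sum_{u\in S_n}t^{d(u)}$, where $d(u)=|\{i: 1\le i\le n-1,\ u_i>u_{i+1}\}|$. *)

(* Defs.v *)
From HB Require Import structures.
From mathcomp Require Import all_boot all_order all_algebra all_fingroup.

Set Implicit Arguments.
Unset Strict Implicit.
Unset Printing Implicit Defensive.

Import Order.TTheory GRing.Theory Num.Theory.
Local Open Scope ring_scope.

(* The letter u_i of the word of u, for i counted from 1 and with values in
   {1, ..., n}, whereas 'S_n acts on {0, ..., n-1}.  The value is 0 outside
   {1, ..., n}, which gives the convention u_0 = u_(n+1) = 0. *)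
Definition perm_letter (n : nat) (u : 'S_n) (i : nat) : nat :=
  if i is j.+1 then oapp (fun k : 'I_n => (u k).+1) 0%N (insub j) else 0%N.

Definition is_peak (n : nat) (u : 'S_n) (i : nat) : bool :=
  ((perm_letter u i.-1 < perm_letter u i) &&
   (perm_letter u i.+1 < perm_letter u i))%N.

Definition pk (n : nat) (u : 'S_n) : nat :=
  #|[set i : 'I_n.+1 | (2 <= i <= n.-1)%N && is_peak u i]|.

Definition lpk (n : nat) (u : 'S_n) : nat :=
  #|[set i : 'I_n.+1 | (1 <= i <= n.-1)%N && is_peak u i]|.

Definition epk (n : nat) (u : 'S_n) : nat :=
  #|[set i : 'I_n.+1 | (1 <= i <= n)%N && is_peak u i]|.

Definition perm_des (n : nat) (u : 'S_n) : nat :=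
  #|[set i : 'I_n.+1 | (1 <= i <= n.-1)%N &&
                       (perm_letter u i.+1 < perm_letter u i)%N]|.

(* The set {1, -1, ..., n, -n}: the pair (b, k) stands for (-1)^b (k+1). *)
Definition signed (n : nat) : finType := (bool * 'I_n)%type.

Definition signed_val (n : nat) (x : signed n) : int :=
  (-1) ^+ x.1 * (x.2.+1)%:Z.

Definition signed_opp (n : nat) (x : signed n) : signed n := (~~ x.1, x.2).

Lemma signed_val_opp (n : nat) (x : signed n) :
  signed_val (signed_opp x) = - signed_val x.
Proof. by rewrite /signed_val /= signrN mulNr. Qed.

Definition signed_perms (n : nat) : {set {perm signed n}} :=
  [set w : {perm signed n} | [forall x, w (signed_opp x) == signed_opp (w x)]].

Lemma signed_perms_group_set (n : nat) : group_set (signed_perms n).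
Proof.
apply/group_setP; split=> [|v w].
  by rewrite inE; apply/forallP => x; rewrite !perm1.
rewrite !inE => /forallP hv /forallP hw; apply/forallP => x.
by rewrite !permM (eqP (hv x)) (eqP (hw (v x))).
Qed.

Canonical signed_perms_group (n : nat) : {group {perm signed n}} :=
  Group (signed_perms_group_set n).

(* The letter w_i = w(i) for 1 <= i <= n, with the convention w_0 = 0. *)
Definition signed_letter (n : nat) (w : {perm signed n}) (i : nat) : int :=
  if i is j.+1
  then oapp (fun k : 'I_n => signed_val (w (false, k))) 0 (insub j)
  else 0.

Definition Des (n : nat) (w : {perm signed n}) : {set 'I_n.+1} :=
  [set i : 'I_n.+1 | (1 <= i)%N && (signed_letter w i < signed_letter w i.-1)].

Definition affDes (n : nat) (w : {perm signed n}) : {set 'I_n.+1} :=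
  Des w :|: [set i : 'I_n.+1 | (i == ord0) && (0 < signed_letter w n)].

Definition eulerianC (n : nat) : {poly rat} :=
  \sum_(w in signed_perms n) 'X^#|Des w|.

Definition aff_eulerianC (n : nat) : {poly rat} :=
  \sum_(w in signed_perms n) 'X^#|affDes w|.

(* Indexed by the symmetric group: this is the polynomial usually written
   A_(n-1), of degree n - 1 for n >= 1. *)
Definition eulerianA (n : nat) : {poly rat} :=
  \sum_(u : 'S_n) 'X^(perm_des u).

(* Main.v *)
(* Write a signed permutation as w = (sign vector s, permutation u = |w|).  With
   u fixed, whether two adjacent letters form a descent of w depends only on the
   sign of the one with the larger absolute value, so the sum of t^des over the
   sign vectors factors over the positions: a peak of u contributes t + t, a
   valley 1 + 1, every other position 1 + t.  Which of the two end pairs (with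
   u_0 = u_(n+1) = 0) are counted distinguishes epk, lpk and pk.  When neither
   is, standardization shows that the total over w is 2^n times the Eulerian
   polynomial of S_n. *)
Require Import Defs.
From mathcomp Require Import all_boot all_order all_algebra all_fingroup.
From mathcomp Require Import zify ring.

Set Implicit Arguments.
Unset Strict Implicit.
Unset Printing Implicit Defensive.

Import Order.TTheory GRing.Theory Num.Theory.
Local Open Scope ring_scope.

(** * Letters of permutations and of signed words *)

Section Letters.
Variables (n : nat) (u : 'S_n).

Lemma perm_letter_ord (j : 'I_n) : perm_letter u j.+1 = (u j).+1.
Proof. by rewrite /perm_letter valK. Qed.

Lemma perm_letter_gt (i : nat) : (n < i)%N -> perm_letter u i = 0%N.
Proof. by case: i => // j; rewrite ltnS leqNgt => /negbTE jn; rewrite /= insubF. Qed.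

(** At either end of a nonempty word one letter of the pair is the conventional 0 and the other is
    positive. *)
Lemma perm_letter_neq (i : nat) :
  (0 < n)%N -> (i <= n)%N -> perm_letter u i != perm_letter u i.+1.
Proof.
move=> n_gt0; case: i => [|i] i_le; first by rewrite (perm_letter_ord (Ordinal n_gt0)).
rewrite (perm_letter_ord (Ordinal i_le)).
have [lt_in|le_ni] := ltnP i.+1 n; last by rewrite (@perm_letter_gt i.+2).
rewrite (perm_letter_ord (Ordinal lt_in)) eqSS (inj_eq val_inj) (inj_eq perm_inj).
by rewrite -val_eqE /= neq_ltn ltnSn.
Qed.

Definition letter_sign (s : {ffun 'I_n -> bool}) (i : nat) : bool :=
  if i is j.+1 then oapp s false (insub j) else false.

(* The letter (-1)^(s_i) u_i, with the conventions u_0 = u_(n+1) = 0. *)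
Definition signed_word (s : {ffun 'I_n -> bool}) (i : nat) : int :=
  (-1) ^+ letter_sign s i * (perm_letter u i)%:Z.

End Letters.

(** The larger absolute value decides: a larger [q] gives a descent exactly when its sign [b] is
    minus, a larger [p] exactly when its sign [a] is plus. *)
Lemma signed_ltE (a b : bool) (p q : nat) : p != q ->
  ((-1) ^+ b * q%:Z < (-1) ^+ a * p%:Z :> int) = (if (p < q)%N then b else ~~ a).
Proof. by case: a b => [] [] /= /eqP; case: ltnP; lia. Qed.

(* A pair of adjacent letters is charged to the position of its larger letter;
   [j] below stands for the position [j.+1]. *)
Lemma sum_adjacent (n l r : nat) (x F H : nat -> nat) :
  x 0%N = 0%N -> x n.+1 = 0%N ->
  (forall i, (i <= n)%N -> x i != x i.+1) ->
  (l <= 1)%N -> (n <= r <= n.+1)%N ->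
  (\sum_(l <= i < r) (if x i < x i.+1 then F i.+1 else H i) =
   \sum_(j < n) (((l <= j) && (x j < x j.+1)) * F j.+1 +
                 ((j.+1 < r) && (x j.+2 < x j.+1)) * H j.+1))%N.
Proof.
move=> x0 xn xneq l1 /andP[nr rn].
have -> : (\sum_(l <= i < r) (if x i < x i.+1 then F i.+1 else H i) =
  \sum_(0 <= i < n.+1) (((l <= i < r) && (x i < x i.+1)) * F i.+1 +
                        ((l <= i < r) && (x i.+1 < x i)) * H i))%N.
  rewrite (big_nat_widen _ _ n.+1) // (big_nat_widenl _ 0) // big_mkcond /=.
  apply: eq_big_nat => i /andP[_ i_le]; rewrite andbC.
  case: (_ <= i < r)%N => //=; have := xneq i i_le.
  by case: ltngtP => // _ _; rewrite ?mul1n ?mul0n ?addn0.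
(* The ascent term at [i = n] and the descent term at [i = 0] vanish because [x] is 0 at both ends,
   so both sums run over [n] positions. *)
rewrite !big_split /= big_nat_recr //= xn ltn0 andbF mul0n addn0.
congr addn; last rewrite big_nat_recl //= x0 ltn0 andbF mul0n add0n.
  rewrite big_mkord; apply: eq_bigr => j _.
  by rewrite (leq_trans (ltn_ord j) nr) andbT.
rewrite big_mkord; apply: eq_bigr => j _.
by rewrite (leq_trans l1).
Qed.

(** * Summation over the signs of a fixed permutation *)

Lemma sum_signs_prod (R : comNzRingType) (t : R) (I : finType) (c d : pred I) :
  \sum_(s : {ffun I -> bool}) t ^+ (\sum_i (c i * s i + d i * ~~ s i))%N =
  \prod_i (t ^+ c i + t ^+ d i).
Proof.
transitivity (\prod_i \sum_(b : bool) t ^+ (c i * b + d i * ~~ b)%N).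
  by rewrite bigA_distr_bigA; apply: eq_bigr => s _; rewrite expr_sum.
by apply: eq_bigr => i _; rewrite big_bool /= !muln1 !muln0 addn0 add0n.
Qed.

(* With [p] indices where both hold, [v] where none does and [m] others, one has
   [m + 2p = k] and [v + p + m] = #|I|, so [2^k (2t)^p 2^v = 2^#|I| (4t)^p]. *)
Lemma prod_peaks (R : comNzRingType) (t : R) (I : finType) (c d : pred I) (k : nat) :
  (\sum_i (c i + d i))%N = k ->
  let p := (\sum_i (c i && d i))%N in
  2 ^+ k * \prod_i (t ^+ c i + t ^+ d i) =
  2 ^+ #|I| * ((4 * t) ^+ p * (1 + t) ^+ (k - 2 * p)).
Proof.
move=> <- p.
have -> : (\sum_i (c i + d i) - 2 * p = \sum_i (c i (+) d i))%N.
  rewrite big_distrr -sumnB => [|i _]; last by case: (c i) (d i) => [] [].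
  by apply: eq_bigr => i _; case: (c i) (d i) => [] [].
rewrite /p -sum1_card !expr_sum -!big_split /=; apply: eq_bigr => i _.
by case: (c i) (d i) => [] [] /=; ring.
Qed.

(** The bounds select the [r - l] adjacent pairs that count: [l = 0] includes the initial pair,
    [r = n.+1] the final one. *)
Lemma sum_signed_words (n : nat) (u : 'S_n) (l r : nat) (R : comNzRingType) (t : R) :
  (0 < n)%N -> (l <= 1)%N -> (n <= r <= n.+1)%N ->
  let p := (\sum_(j < n) [&& l <= j, j.+1 < r & is_peak u j.+1])%N in
  2 ^+ (r - l) * \sum_(s : {ffun 'I_n -> bool})
    t ^+ (\sum_(l <= i < r) (signed_word u s i.+1 < signed_word u s i)%R)%N =
  2 ^+ n * ((4 * t) ^+ p * (1 + t) ^+ (r - l - 2 * p)).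
Proof.
move=> n0 l1 rn p; set x := perm_letter u.
have xneq i : (i <= n)%N -> x i != x i.+1 by exact: perm_letter_neq.
have xn : x n.+1 = 0%N by exact: perm_letter_gt.
(* At position [j.+1], [c] marks a counted descent produced by a minus sign and [d] one produced by
   a plus sign; both hold exactly at the counted peaks. *)
pose c (j : 'I_n) := (l <= j)%N && (x j < x j.+1)%N.
pose d (j : 'I_n) := (j.+1 < r)%N && (x j.+2 < x j.+1)%N.
have kE : (\sum_j (c j + d j))%N = (r - l)%N.
  rewrite -[RHS]muln1 -sum_nat_const_nat.
  transitivity (\sum_(l <= i < r) if (x i < x i.+1)%N then 1 else 1)%N; last first.
    by apply: eq_bigr => i _; rewrite if_same.
  rewrite (@sum_adjacent n l r x (fun=> 1%N) (fun=> 1%N)) //.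
  by apply: eq_bigr => j _; rewrite !muln1.
have pE : p = (\sum_j (c j && d j))%N.
  by apply: eq_bigr => j _; rewrite /c /d andbACA -andbA.
have /= := prod_peaks t kE; rewrite card_ord -pE => <-.
congr (_ * _); rewrite -sum_signs_prod; apply: eq_bigr => s _; congr (_ ^+ _).
pose sg := letter_sign s.
transitivity (\sum_(l <= i < r)
    if x i < x i.+1 then nat_of_bool (sg i.+1) else nat_of_bool (~~ sg i))%N.
  apply: eq_big_nat => i /andP[_ ir]; rewrite /signed_word signed_ltE; first by case: ifP.
  by apply: xneq; lia.
rewrite (@sum_adjacent n l r x sg (fun i => ~~ sg i)) //.
by apply: eq_bigr => j _; rewrite /sg /letter_sign valK.
Qed.

(** * Signed permutations as pairs of a permutation and a sign vector *)

Section SignedPerms.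
Variable n : nat.

Definition sign_perm_fun (us : 'S_n * {ffun 'I_n -> bool}) (x : signed n) : signed n :=
  (x.1 (+) us.2 x.2, us.1 x.2).

Lemma sign_perm_inj us : injective (sign_perm_fun us).
Proof. by move=> [a i] [b j] [+ /perm_inj eij]; rewrite eij => /addIb ->. Qed.

Definition sign_perm us : {perm signed n} := perm (@sign_perm_inj us).

Lemma signed_letter_sign_perm u s i :
  signed_letter (sign_perm (u, s)) i = signed_word u s i.
Proof.
rewrite /signed_letter /signed_word /letter_sign /perm_letter; case: i => [|i] /=; first by rewrite mulr0.
case: insubP => [k _ _|_] //=.
by rewrite permE.
Qed.

Lemma sum_signed_perms (V : nmodType) (F : {perm signed n} -> V) :
  \sum_(w in signed_perms n) F w =
  \sum_(u : 'S_n) \sum_(s : {ffun 'I_n -> bool}) F (sign_perm (u, s)).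
Proof.
have <- : sign_perm @: setT = signed_perms n.
  apply/setP=> w; apply/imsetP/idP => [[us _ ->]|].
    by rewrite inE; apply/forallP => x; rewrite !permE /signed_opp /sign_perm_fun /= addNb.
  rewrite inE => /forallP w_opp.
  have uinj : injective (fun k => (w (false, k)).2).
    move=> i j eij.
    have [e|ne] := eqVneq (w (false, i)).1 (w (false, j)).1.
      suff /perm_inj [] : w (false, i) = w (false, j) by [].
      by rewrite [LHS]surjective_pairing e eij -surjective_pairing.
    (* Equal absolute values with opposite signs would make [w] agree at the distinct arguments [i]
       and [-j]. *)
    suff /perm_inj // : w (false, i) = w (true, j) by [].
    have /eqP -> := w_opp (false, j).
    rewrite [LHS]surjective_pairing eij; congr pair.
    by move: ne; case: (w (false, i)).1 (w (false, j)).1 => [] [].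
  exists (perm uinj, [ffun k => (w (false, k)).1]) => //.
  apply/permP => -[b k]; rewrite permE /sign_perm_fun /= permE ffunE.
  case: b; first by have /eqP -> := w_opp (false, k).
  by rewrite -surjective_pairing.
rewrite big_imset /=.
  by rewrite pair_bigA; apply: eq_big => [us|[]//]; rewrite inE.
move=> [u s] [v t] _ _ /permP e; congr pair.
  by apply/permP => k; have := e (false, k); rewrite !permE => -[].
by apply/ffunP => k; have := e (false, k); rewrite !permE => -[].
Qed.

End SignedPerms.

(* Signs attached to the values, rather than the positions, select one of k, -k
   for each k; standardization with respect to the order of the selected
   integers then permutes S_n. *)
Lemma sum_signed_words_des (n : nat) (R : pzRingType) (t : R) :
  \sum_(u : 'S_n) \sum_(s : {ffun 'I_n -> bool})
    t ^+ (\sum_(1 <= i < n) (signed_word u s i.+1 < signed_word u s i)%R)%N =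
  2 ^+ n * \sum_(u : 'S_n)
    t ^+ (\sum_(1 <= i < n) (perm_letter u i.+1 < perm_letter u i))%N.
Proof.
transitivity (\sum_(u : 'S_n) \sum_(e : {ffun 'I_n -> bool})
    t ^+ (\sum_(1 <= i < n) (signed_word u [ffun k => e (u k)] i.+1
      < signed_word u [ffun k => e (u k)] i)%R)%N).
  apply: eq_bigr => u _.
  rewrite (reindex (fun e : {ffun 'I_n -> bool} => [ffun k => e (u k)])) //=.
  exists (fun s : {ffun 'I_n -> bool} => [ffun k => s (u^-1%g k)]) => s _;
    by apply/ffunP => k; rewrite !ffunE ?permK ?permKV.
(* Each of the [2 ^ n] choices of [e] is shown to contribute the same unsigned sum. *)
rewrite exchange_big /= -[n in 2 ^+ n]card_ord -card_bool -natrX -card_ffun.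
rewrite mulr_natl -sumr_const; apply: eq_bigr => e _.
pose y (k : 'I_n) : int := (-1) ^+ e k * k.+1%:Z.
have y_inj : injective y.
  move=> i j; rewrite /y => eij; apply: val_inj; move: eij.
  by case: (e i) (e j) => [] [] /=; lia.
(* The rank of [y k] among the selected integers is at most [n - 1], since [k] itself is not
   counted. *)
have rk_lt k : (#|[set j | (y j < y k)%R]| < n)%N.
  rewrite -[X in (_ < X)%N]card_ord -cardsT proper_card //.
  by apply/properP; split; [exact: subsetT | exists k; rewrite // !inE ltxx].
pose rk k := Ordinal (rk_lt k).
have rk_homo i j : y i < y j -> (rk i < rk j)%N.
  move=> lt_ij; apply: proper_card; apply/properP; split.
    by apply/subsetP => k; rewrite !inE => /lt_trans; apply.
  by exists i; rewrite !inE ?ltxx.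
have rk_mono i j : (rk i < rk j)%N = (y i < y j).
  apply/idP/idP; last exact: rk_homo.
  case: (ltgtP (y i) (y j)) => // [/rk_homo|/y_inj ->]; last by rewrite ltnn.
  by move=> lt_ji /ltn_trans/(_ lt_ji); rewrite ltnn.
have rk_inj : injective rk.
  move=> i j eij; apply/y_inj/eqP; rewrite eq_le !leNgt -!rk_mono eij.
  by rewrite ltnn.
(* Products act from left to right, so [u * perm rk_inj] replaces each letter of the signed word by
   its rank, which preserves descents. *)
rewrite [RHS](reindex_inj (mulIg (perm rk_inj))) /=; apply: eq_bigr => u _.
congr (_ ^+ _); apply: eq_big_nat => -[|i] // /andP[_ lt_in].
have wordE (k : 'I_n) : signed_word u [ffun j => e (u j)] k.+1 = y (u k).
  by rewrite /signed_word /letter_sign perm_letter_ord valK /= ffunE.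
have lt_in' := ltnW lt_in.
rewrite (wordE (Ordinal lt_in)) (wordE (Ordinal lt_in')).
have letterE (k : 'I_n) : perm_letter (u * perm rk_inj) k.+1 = (rk (u k)).+1.
  by rewrite perm_letter_ord permM permE.
by rewrite -rk_mono -ltnS -!letterE.
Qed.

Lemma card_set_ord (n : nat) (P : pred 'I_n) : #|[set i | P i]| = (\sum_i P i)%N.
Proof. by rewrite -sum1_card big_mkcond; apply: eq_bigr => i _; rewrite inE; case: (P i). Qed.

(** * The statistics as sums over positions or adjacent pairs *)

Section Statistics.
Variables (n : nat) (u : 'S_n).
Hypothesis n_gt0 : (0 < n)%N.

Lemma epkE : epk u =
  (\sum_(j < n) [&& 0 <= j, j.+1 < n.+1 & is_peak u j.+1])%N.
Proof.
by rewrite /epk card_set_ord big_ord_recl; apply: eq_bigr => j _; rewrite -andbA.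
Qed.

Lemma lpkE : lpk u = (\sum_(j < n) [&& 0 <= j, j.+1 < n & is_peak u j.+1])%N.
Proof.
rewrite /lpk card_set_ord big_ord_recl; apply: eq_bigr => j _.
have -> : (j.+1 < n)%N = (j.+1 <= n.-1)%N by lia.
by rewrite -andbA.
Qed.

Lemma pkE : pk u = (\sum_(j < n) [&& 1 <= j, j.+1 < n & is_peak u j.+1])%N.
Proof.
rewrite /pk card_set_ord big_ord_recl; apply: eq_bigr => j _.
have -> : (j.+1 < n)%N = (j.+1 <= n.-1)%N by lia.
by rewrite -andbA lift0 ltnS.
Qed.

Lemma perm_desE : perm_des u =
  (\sum_(1 <= i < n) (perm_letter u i.+1 < perm_letter u i))%N.
Proof.
rewrite /perm_des card_set_ord.
rewrite (big_nat_widenl _ 0) // (big_nat_widen _ _ n.+1) // big_mkord [RHS]big_mkcond.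
apply: eq_bigr => i _; have -> : (i < n)%N = (i <= n.-1)%N by lia.
by case: (_ <= i <= _)%N.
Qed.

Variable s : {ffun 'I_n -> bool}.

Lemma card_Des : #|Des (sign_perm (u, s))| =
  (\sum_(0 <= i < n) (signed_word u s i.+1 < signed_word u s i)%R)%N.
Proof.
rewrite /Des card_set_ord big_ord_recl big_mkord; apply: eq_bigr => i _.
by rewrite lift0 !signed_letter_sign_perm.
Qed.

(** The affine descent at 0 is a descent from the last letter to a further letter 0, hence the final
    term of the sum. *)
Lemma card_affDes : #|affDes (sign_perm (u, s))| =
  (\sum_(0 <= i < n.+1) (signed_word u s i.+1 < signed_word u s i)%R)%N.
Proof.
have -> : affDes (sign_perm (u, s)) =
  [set i : 'I_n.+1 | if i == ord0 then 0 < signed_word u s n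
     else signed_word u s i < signed_word u s i.-1].
  apply/setP => i; rewrite !inE !signed_letter_sign_perm -val_eqE /=.
  by case: (val i) => [|k]; rewrite //= orbF.
rewrite card_set_ord big_ord_recl big_nat_recr //= addnC big_mkord.
by congr addn; rewrite /signed_word (@perm_letter_gt n u n.+1) // mulr0.
Qed.

End Statistics.

Theorem corollary5p6 (n : nat) (n_ge1 : (1 <= n)%N) :
  [/\ aff_eulerianC n =
        (1 / 2) *: \sum_(u : 'S_n)
          (4 *: 'X) ^+ epk u * (1 + 'X) ^+ (n + 1 - 2 * epk u)%N,
      eulerianC n =
        \sum_(u : 'S_n)
          (4 *: 'X) ^+ lpk u * (1 + 'X) ^+ (n - 2 * lpk u)%N
    & eulerianA n =
        (2 ^- (n - 1)%N) *: \sum_(u : 'S_n)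
          (4 *: 'X) ^+ pk u * (1 + 'X) ^+ (n - 1 - 2 * pk u)%N ].
Proof.
have X4 : 4 *: 'X = 4 * 'X :> {poly rat} by rewrite -mul_polyC polyC_natr.
have exp2_neq0 k : 2 ^+ k != 0 :> {poly rat}.
  by rewrite expf_neq0 // -polyC_natr polyC_eq0.
have words u l r := @sum_signed_words n u l r _ ('X : {poly rat}) n_ge1.
have exp2E k (P : {poly rat}) : 2 ^+ k * P = 2 ^+ k *: P.
  by rewrite -natrX mulr_natl -scaler_nat natrX.
rewrite X4; split.
(* There are [n.+1] adjacent pairs; the factor 1/2 cancels one of the [n.+1] factors 2 on the
   right. *)
- apply: (mulfI (exp2_neq0 n.+1)).
  rewrite [RHS]exp2E scalerA [in RHS]exprSr div1r mulfK // -exp2E.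
  rewrite /aff_eulerianC sum_signed_perms !mulr_sumr; apply: eq_bigr => u _.
  rewrite epkE addn1.
  have := words u 0%N n.+1 isT; rewrite leqnSn leqnn subn0 => /(_ isT) <-.
  by congr (_ * _); apply: eq_bigr => s _; rewrite card_affDes.
- apply: (mulfI (exp2_neq0 n)); rewrite /eulerianC sum_signed_perms !mulr_sumr.
  apply: eq_bigr => u _; rewrite lpkE //.
  have := words u 0%N n isT; rewrite leqnSn leqnn subn0 => /(_ isT) <-.
  by congr (_ * _); apply: eq_bigr => s _; rewrite card_Des.
(* The factor [2 ^+ n] passes from permutations to signed words, and [2 ^+ (n - 1)] accounts for the
   [n - 1] inner pairs. *)
- apply: (mulfI (exp2_neq0 n)); apply: (mulfI (exp2_neq0 (n - 1)%N)).
  rewrite [in RHS]mulrCA [in RHS](exp2E (n - 1)%N) scalerA divff ?expf_neq0 // scale1r.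
  have -> : eulerianA n = \sum_(u : 'S_n)
      'X^(\sum_(1 <= i < n) (perm_letter u i.+1 < perm_letter u i))%N.
    by apply: eq_bigr => u _; rewrite perm_desE.
  rewrite -sum_signed_words_des !mulr_sumr; apply: eq_bigr => u _.
  by rewrite pkE // words ?leqnSn ?leqnn.
Qed.
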